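(* Let $1\le p<\infty$, let $(X,d)$ be a metric space with the Heine-Borel property, and let $\mu\in\mathcal{P}_p(X)$. Let $Y_1,Y_2,\ldots$ be i.i.d. $X$-valued random elements with common distribution $\mu$ defined on a complete probability space, and let $\bar\mu_n=\frac1n\sum_{i=1}^n\delta_{Y_i}$. (a) If $F_p(\mu)=[x]_\mu$ for some $x\in X$, then $F_p(\bar\mu_n)\to F_p(\mu)$ in $\tau_F\vee\tau_H^+$ almost surely. (b) If $F_p^\ast(\mu)=[x]_\mu$ for some $x\in X$, then $F_p^\ast(\bar\mu_n)\to F_p^\ast(\mu)$ in $\tau_F\vee\tau_H^+$ almost surely.
   Context: A metric space has the Heine-Borel property if its closed bounded subsets are compact. $\mathcal{P}_p(X)$ is the set of Borel probability measures $\mu$ on $X$ with $\int_X d^p(x,y)\,d\mu(y)<\infty$ for all $x\in X$. For $\mu\in\mathcal{P}_p(X)$, $F_p(\mu)=\arg\min_{x\in X}\int_X d^p(x,y)\,d\mu(y)$ and $F_p^\ast(\mu)=\arg\min_{x\in\mathrm{supp}(\mu)}\int_X d^p(x,y)\,d\mu(y)$, where $\mathrm{supp}(\mu)$ is the set of points all of whose open neighborhoods have positive $\mu$-measure. Under the Heine-Borel property these are non-empty compact sets. Equivalence relation: for $x,x'\in X$ write $x\leadsto_\mu x'$ if, for all sufficiently small $\varepsilon>0$, there exists a measurable map $\phi:B_\varepsilon(x)\to B_\varepsilon(x')$ such that for every $z\in B_\varepsilon(x)$, $d(\phi(z),\cdot)=d(z,\cdot)$ holds $\mu$-almost everywhere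 ($B_\varepsilon(x)$ is the open ball of radius $\varepsilon$ about $x$). Write $x\sim_\mu x'$ if $x\leadsto_\mu x'$ and $x'\leadsto_\mu x$; this is an equivalence relation, and $[x]_\mu$ denotes the equivalence class of $x$. Topologies: $\mathrm{K}(X)$ is the collection of non-empty compact subsets of $X$; $\rho(C,C')=\max_{x\in C}\min_{x'\in C'}d(x,x')$; $\tau_H^+$ is the topology on $\mathrm{K}(X)$ in which $C_n\to C$ iff $\rho(C_n,C)\to0$. $\tau_F$ is (the restriction to $\mathrm{K}(X)$ of) the Fell topology; since $X$ is locally compact, $C_n\to C$ in $\tau_F$ iff $C_n$ converges to $C$ in the Kuratowski sense, i.e. $\mathrm{Li}_{n\to\infty}C_n=\mathrm{Ls}_{n\to\infty}C_n=C$, where $\mathrm{Ls}_{n\to\infty} C_n$ (respectively $\mathrm{Li}_{n\to\infty} C_n$) is the set of $x$ such that every open neighborhood of $x$ meets $C_n$ for infinitely many $n$ (respectively for all sufficiently large $n$). $\tau_F\vee\tau_H^+$ is the join of the two topologies on $\mathrm{K}(X)$, so convergence in it means convergence in both. *)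

(* Defs.v *)
From HB Require Import structures.
From mathcomp Require Import all_boot all_order all_algebra finmap.
From mathcomp Require Import all_classical all_reals all_analysis.

Set Implicit Arguments.
Unset Strict Implicit.
Unset Printing Implicit Defensive.

Import Order.TTheory GRing.Theory Num.Def Num.Theory.
Import numFieldNormedType.Exports.

Local Open Scope classical_set_scope.
Local Open Scope ring_scope.

(* Measurable types are pointed in the library, so a space carrying a Borel
   sigma-algebra has to be.  This only asserts nonemptiness, which the existence
   of a probability measure implies anyway. *)
#[short(type="pointedMetricType")]
HB.structure Definition PointedMetric (R : numDomainType) :=
  { M of Metric R M & Pointed M }.

Section MetricMeasure.
Context {R : realType} (X : pointedMetricType R).

Definition borel := g_sigma_algebraType (@open X).

Definition metric_bounded (A : set X) :=
  exists M : R, forall x y, A x -> A y -> mdist x y <= M.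

Definition heine_borel :=
  forall A : set X, closed A -> metric_bounded A -> compact A.

End MetricMeasure.

Section FrechetMean.
Context {R : realType} {X : pointedMetricType R}.
Implicit Types (p : R) (mu : {measure set (borel X) -> \bar R}) (x : X).

Definition frechet_functional p mu x : \bar R :=
  (\int[mu]_(y in [set: borel X]) ((mdist x (y : X)) `^ p)%:E)%E.

Definition finite_moment p mu :=
  forall x, (frechet_functional p mu x < +oo)%E.

Definition msupport mu : set X :=
  [set x | forall U : set X, open U -> U x -> (0 < mu U)%E].

Definition frechet_mean p mu : set X :=
  [set x | forall x', (frechet_functional p mu x
                       <= frechet_functional p mu x')%E].

Definition restricted_frechet_mean p mu : set X :=
  [set x | msupport mu x /\
    forall x', msupport mu x' -> (frechet_functional p mu x
                                 <= frechet_functional p mu x')%E].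

(* A map between balls is a total map sending the first ball into the second;
   only its restriction to the first ball is constrained. *)
Definition leadsto mu x x' :=
  \forall e \near (0 : R)^'+, exists phi : borel X -> borel X,
    [/\ measurable_fun (ball x e : set (borel X)) phi,
        forall z : X, ball x e z -> ball x' e (phi z : X) &
        forall z : X, ball x e z ->
          {ae mu, forall y : borel X,
            mdist (phi z : X) (y : X) = mdist z (y : X)}].

Definition mu_equiv mu x x' := leadsto mu x x' /\ leadsto mu x' x.

Definition mu_class mu x : set X := [set x' | mu_equiv mu x x'].

(* The mean of the Dirac masses at y 0, ..., y (n - 1); meaningful for n > 0. *)
Definition empirical (y : nat -> borel X) (n : nat) :
    {measure set (borel X) -> \bar R} :=
  mscale (n%:R^-1)%:nng (msum (fun k => \d_(y k)) n).

End FrechetMean.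

Section IID.
Context {R : realType} d d' {Omega : measurableType d} {T : measurableType d'}.

Definition mutually_independent (P : probability Omega R)
    (Y : nat -> {RV P >-> T}) :=
  forall (J : {fset nat}) (A : nat -> set T),
    (forall i, measurable (A i)) ->
    P (\bigcap_(i in [set` J]) (Y i @^-1` A i)) =
    (\prod_(i <- J) P (Y i @^-1` A i))%E.

Definition iid (P : probability Omega R) (Y : nat -> {RV P >-> T})
    (mu : probability T R) :=
  mutually_independent Y /\
  forall i (A : set T), measurable A -> distribution P (Y i) A = mu A.

End IID.

Section Hyperspace.
Context {R : realType} (X : pointedMetricType R).

Record compacts := Compacts {
  compacts_set :> set X;
  compacts_nonempty : compacts_set !=set0;
  compacts_compact : compact compacts_set }.

HB.instance Definition _ := gen_eqMixin compacts.
HB.instance Definition _ := gen_choiceMixin compacts.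

(* On nonempty compact sets this supremum and these infima are attained, so
   this is the max-min of the distances. *)
Definition excess (C C' : compacts) : R :=
  sup [set inf [set mdist x x' | x' in (C' : set X)] | x in (C : set X)].

Definition fell := compacts.
HB.instance Definition _ := Choice.on fell.

Definition fell_subbase : set_system fell :=
  [set [set C : fell | (C : set X) `&` U !=set0] | U in @open X] `|`
  [set [set C : fell | (C : set X) `&` K = set0] | K in @compact X].

HB.instance Definition _ := isSubBaseTopological.Build fell fell_subbase id.

Definition upper_hausdorff := compacts.
HB.instance Definition _ := Choice.on upper_hausdorff.

(* The balls of the asymmetric distance [excess] around C bound the excess of
   the moving set over C, so that C_n --> C iff excess C_n C --> 0. *)
Definition upper_hausdorff_open : set_system upper_hausdorff :=
  [set U | forall C, U C -> exists2 e : R, 0 < e &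
    forall C' : compacts, excess C' C < e -> U C'].

Lemma upper_hausdorff_openT : upper_hausdorff_open setT.
Proof. by move=> C _; exists 1. Qed.

Lemma upper_hausdorff_openI (A B : set upper_hausdorff) :
  upper_hausdorff_open A -> upper_hausdorff_open B ->
  upper_hausdorff_open (A `&` B).
Proof.
move=> oA oB C [/oA[e e0 eA] /oB[f f0 fB]].
exists (Num.min e f); first by rewrite lt_min e0.
by move=> C'; rewrite lt_min => /andP[/eA ? /fB].
Qed.

Lemma upper_hausdorff_open_bigU (I : Type) (f : I -> set upper_hausdorff) :
  (forall i, upper_hausdorff_open (f i)) ->
  upper_hausdorff_open (\bigcup_i f i).
Proof.
move=> of_ C [i _ /of_[e e0 ef]].
by exists e => // C' /ef ?; exists i.
Qed.

HB.instance Definition _ := isOpenTopological.Build upper_hausdorff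
  upper_hausdorff_openT upper_hausdorff_openI upper_hausdorff_open_bigU.

Definition fell_join_upper_hausdorff := @sup_topology compacts bool
  (fun b => if b then Topological.on fell else Topological.on upper_hausdorff).
HB.instance Definition _ := Topological.on fell_join_upper_hausdorff.

(* Convergence in the join of a sequence of sets; membership of all the sets in
   the hyperspace is part of the claim. *)
Definition cvg_fell_upper_hausdorff (A : nat -> set X) (B : set X) :=
  exists (C : nat -> fell_join_upper_hausdorff) (D : fell_join_upper_hausdorff),
    [/\ forall n, compacts_set (C n) = A n,
        compacts_set D = B &
        C n @[n --> \oo] --> D].

End Hyperspace.

(* Main.v *)
(* Write the p-th root of the Frechet functional of a measure as the L^p norm of
   the distance function; by Minkowski's inequality it is 1-Lipschitz, and the
   sum of its values at x and y bounds d(x, y).  The strong law of large numbers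
   along a countable dense set then gives almost surely the convergence of the
   empirical roots everywhere, and compactness forces the empirical minimisers
   into any neighbourhood of the set of population minimisers (for the restricted
   means one also uses that the sample comes arbitrarily close to a point of the
   support).  For the lower half of Fell convergence, the set where d(phi z, .)
   and d(z, .) agree is closed of full measure, so it contains the support and
   hence almost surely the whole sample, simultaneously for all z: the twin
   phi z of an empirical minimiser z is again one.  In the restricted case the
   twin of a point of the support is the point itself, so the equivalence class
   is a singleton.  The strong law is Etemadi's: truncation, variances along a
   subsequence growing geometrically, and monotone interpolation. *)

Require Import Defs.
From HB Require Import structures.
From mathcomp Require Import all_boot all_order all_algebra finmap.
From mathcomp Require Import all_classical all_reals all_analysis.
From mathcomp Require Import measurable_realfun zify ring lra.

Import Order.TTheory GRing.Theory Num.Theory.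
Import numFieldNormedType.Exports.
Local Open Scope classical_set_scope.
Local Open Scope ring_scope.

(** * Tools for the strong law: summable expectations, geometric subsequences, truncation *)

Lemma ae_cvg0_of_summable {R : realType} {d} {T : measurableType d}
    (P : {measure set T -> \bar R}) (W : nat -> T -> R) (C : R) :
  (forall n, measurable_fun setT (W n)) -> (forall n w, (0 <= W n w)%R) ->
  (forall N, \sum_(0 <= n < N) \int[P]_w (W n w)%:E <= C%:E)%E ->
  {ae P, forall w, W n w @[n --> \oo] --> (0 : R)}.
Proof.
move=> mW W0 WC.
have mWE n : measurable_fun setT (fun w => (W n w)%:E) by exact/measurable_EFinP.
have W0E n w : (0 <= (W n w)%:E)%E by rewrite lee_fin.
(* Monotone convergence bounds the expectation of the whole series by [C], so the series is finite
   almost everywhere and its terms tend to zero. *)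
have intW : P.-integrable setT (fun w => \sum_(0 <= n <oo) (W n w)%:E)%E.
  apply/integrableP; split.
    by apply: (@ge0_emeasurable_sum _ _ _ _ (fun n w => (W n w)%:E) xpredT) => //.
  under eq_integral do rewrite gee0_abs ?nneseries_ge0//.
  rewrite integral_nneseries// (@le_lt_trans _ _ C%:E) ?ltry//.
  apply: lime_le; first by apply: is_cvg_nneseries => n _ _; apply: integral_ge0.
  exact: nearW.
have := integrable_ae measurableT intW.
apply: filterS => w /(_ I) fin.
apply: cvg_series_cvg_0; apply: nondecreasing_is_cvgn.
  by apply: nondecreasing_series => n _ _.
exists (fine (\sum_(0 <= n <oo) (W n w)%:E)%E) => _ [n _ <-].
by rewrite -lee_fin fineK// -sumEFin; apply: nneseries_lim_ge.
Qed.

Lemma probability_integral_cst {R : realType} {d} {T : measurableType d}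
    (P : probability T R) (r : R) : (\int[P]_x r%:E = r%:E)%E.
Proof.
rewrite integral_cst//; transitivity (r%:E * 1%E)%E; last by rewrite mule1.
by congr (_ * _)%E; exact: (probability_setT P).
Qed.


(* Integers growing at rate at least 1 + 1/q and at most about 1 + 1/q. *)
Fixpoint geo (q n : nat) : nat :=
  if n is n'.+1 then (geo q n' + geo q n' %/ q + 1)%N else 1.

Lemma geo_gt0 q n : (0 < geo q n)%N.
Proof. by case: n => // n /=; rewrite addn1. Qed.

Lemma geo_ltS q n : (geo q n < geo q n.+1)%N.
Proof. by rewrite /= addn1 ltnS leq_addr. Qed.

Lemma leq_geo q n : (n <= geo q n)%N.
Proof. by elim: n => // n IH; apply: leq_ltn_trans (geo_ltS q n). Qed.

Lemma geo_ratio {R : realType} q n : (0 < q)%N ->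
  (1 + q%:R^-1) * (geo q n)%:R <= (geo q n.+1)%:R :> R.
Proof.
move=> q0; have q0R : 0 < q%:R :> R by rewrite ltr0n.
rewrite -(ler_pM2l q0R) mulrA mulrDr mulr1 divff ?gt_eqF//.
rewrite -[1](mulr1n 1) -natrD -!natrM ler_nat addn1 mulSn /=.
have := ltn_ceil (geo q n) q0; rewrite mulnC; nia.
Qed.

(* For [T = min(z, k)] truncated at [k], [psi k z] bounds both the normalised
   second moment [T^2 / k] and [k] times the indicator of the truncation; it is
   dominated by the increments of [k z / (k + z)], which stay below [z]. *)
Definition psi {R : realType} (k z : R) : R :=
  Num.min z k ^+ 2 / k + k * (k < z)%R%:R.

(** Monotonicity of [t * z / (t + z)] in [t] reduces [k'] to [s = (1 + q^-1) * k]. The increment is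
    then [z ^+ 2 * (s - k) / ((s + z) * (k + z))], and the cases [k < z] and [z <= k] become
    polynomial inequalities. *)
Lemma psi_le {R : realType} (q k k' z : R) : 0 < q -> 0 < k -> 0 <= z ->
  (1 + q^-1) * k <= k' ->
  psi k z <= 4 * (2 * q + 1) * (k' * z / (k' + z) - k * z / (k + z)).
Proof.
move=> q0 k0 z0 kk'.
pose s := (1 + q^-1) * k.
have sk : q * s = (q + 1) * k by rewrite /s; field; rewrite gt_eqF.
have qk : 0 < q^-1 * k by rewrite mulr_gt0// invr_gt0.
have ks : k < s by rewrite /s; lra.
rewrite -/s in kk'; clearbody s.
have k'0 : 0 < k' by rewrite (lt_le_trans k0)// (le_trans (ltW ks)).
have s0 : 0 < s by lra.
have mono : s * z / (s + z) <= k' * z / (k' + z).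
  rewrite ler_pdivlMr ?ltr_wpDr// mulrAC ler_pdivrMr ?ltr_wpDr//.
  have : 0 <= (k' - s) * z * z by rewrite !mulr_ge0// subr_ge0.
  lra.
apply: le_trans (_ : _ <= 4 * (2 * q + 1) * (s * z / (s + z) - k * z / (k + z))) _; last first.
  by rewrite ler_pM2l ?lerD2r//; lra.
have -> : s * z / (s + z) - k * z / (k + z) = z ^+ 2 * (s - k) / ((s + z) * (k + z)).
  by field; rewrite !gt_eqF// ltr_wpDr.
have D0 : 0 < (s + z) * (k + z) by rewrite mulr_gt0// ltr_wpDr.
have qs : q * (s - k) = k by lra.
rewrite mulrA ler_pdivlMr//.
(* The constant is chosen for the identity [(2 * q + 1) * (s - k) = s + k], which holds because
   [q * (s - k) = k]. *)
have -> : 4 * (2 * q + 1) * (z ^+ 2 * (s - k)) = 4 * z ^+ 2 * (s + k) .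
  have -> : 4 * (2 * q + 1) * (z ^+ 2 * (s - k)) = 4 * z ^+ 2 * (2 * (q * (s - k)) + (s - k)) by ring.
  by rewrite qs; ring.
rewrite /psi; case: ltP => [kz|zk].
- rewrite mulr1.
  have -> : k ^+ 2 / k + k = 2 * k by field; rewrite gt_eqF.
  have : (s + z) * (k + z) * k <= 2 * z ^+ 2 * (s + k); last by move=> H; lra.
  have h1 : 0 <= (z - k) * s * z by rewrite !mulr_ge0 ?subr_ge0// ltW.
  have h2 : 0 <= (z - k) * k * z by rewrite !mulr_ge0 ?subr_ge0// ltW.
  have h3 : 0 <= (z - k) * s * k by rewrite !mulr_ge0 ?subr_ge0// ltW.
  have h4 : 0 <= z * z * s by rewrite !mulr_ge0// ltW.
  have h5 : 0 <= z * z * k by rewrite !mulr_ge0// ltW.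
  lra.
- rewrite mulr0 addr0 mulrAC ler_pdivrMr//.
  have -> : 4 * z ^+ 2 * (s + k) * k = z ^+ 2 * (4 * (s + k) * k) by ring.
  rewrite ler_wpM2l ?sqr_ge0//.
  have h1 : 0 <= (k - z) * s by rewrite mulr_ge0 ?subr_ge0// ltW.
  have h2 : 0 <= (k - z) * k by rewrite mulr_ge0 ?subr_ge0// ltW.
  have h3 : 0 <= (k - z) * z by rewrite mulr_ge0 ?subr_ge0// ltW.
  have h4 : 0 <= s * k by rewrite mulr_ge0// ltW.
  have h5 : 0 <= k * k by rewrite mulr_ge0// ltW.
  lra.
Qed.

(** The bounds of [psi_le] telescope along [geo q], and [k * z / (k + z)] always lies between [0]
    and [z]. *)
Lemma sum_psi_le {R : realType} (q N : nat) (z : R) : (0 < q)%N -> 0 <= z ->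
  \sum_(0 <= n < N) psi (geo q n)%:R z <= 4 * (2 * q%:R + 1) * z.
Proof.
move=> q0 z0; have gp n : 0 < (geo q n)%:R :> R by rewrite ltr0n geo_gt0.
pose th n : R := (geo q n)%:R * z / ((geo q n)%:R + z).
apply: (@le_trans _ _ (\sum_(0 <= n < N) 4 * (2 * q%:R + 1) * (th n.+1 - th n))).
  apply: ler_sum => n _; apply: psi_le => //; first by rewrite ltr0n.
  exact: geo_ratio.
rewrite -mulr_sumr telescope_sumr// ler_wpM2l ?addr_ge0 ?mulr_ge0//.
have : 0 <= th 0 by rewrite divr_ge0 ?mulr_ge0 ?addr_ge0.
suff : th N <= z by lra.
rewrite /th ler_pdivrMr ?ltr_wpDr//; have := gp N; nra.
Qed.

Lemma geo_bracket q N : (0 < N)%N ->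
  exists j, (geo q j <= N < geo q j.+1)%N.
Proof.
move=> N0; have ex : exists j, (geo q j <= N)%N by exists 0.
have ub j : (geo q j <= N)%N -> (j <= N)%N by apply: leq_trans (leq_geo q j).
case: (ex_maxnP ex ub) => j jN jmax; exists j; rewrite jN ltnNge.
by apply/negP => /jmax; rewrite ltnn.
Qed.

(** Rounding adds at most one per step, and [q <= n <= geo q n] makes that one at most
    [geo q n / q]; hence the factor [2 / q]. *)
Lemma geo_ub {R : realType} q n : (0 < q)%N -> (q <= n)%N ->
  (geo q n.+1)%:R <= (1 + 2 / q%:R) * (geo q n)%:R :> R.
Proof.
move=> q0 qn; have q0R : 0 < q%:R :> R by rewrite ltr0n.
rewrite -(ler_pM2l q0R) mulrA mulrDr mulr1 mulrCA divff ?gt_eqF// mulr1.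
rewrite -natrD -!natrM ler_nat.
have := leq_trunc_div (geo q n) q; have := leq_geo q n; rewrite /=; nia.
Qed.

(** Interpolation between subsequence indices [k <= N <= K]: [s] is the partial sum at [N], while
    [a] and [b] are the averages at [k] and [K]. Then [s / N] lies between [a * (1 - t)] and
    [b * (1 + t)], and [a, b <= m + 1] keeps the error below [e / 4 + e / 4]. *)
Lemma average_squeeze {R : realType} (k N K a s b m del t e : R) :
  0 < k -> k <= N -> N <= K -> K <= (1 + t) * k -> a * k <= s -> s <= b * K ->
  0 <= a -> 0 <= b -> 0 <= m -> 0 <= t -> t <= 1 -> t * (m + 1) <= e / 4 ->
  del <= 1 -> del <= e / 4 -> 0 < e -> `|m - a| < del -> `|m - b| < del ->
  `|m - s / N| < e.
Proof.
move=> k0 kN NK Kk ks sK a0 b0 m0 t0 t1 tm del1 dele e0.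
rewrite !ltr_norml => /andP[a1 a2] /andP[b1 b2].
have N0 : 0 < N := lt_le_trans k0 kN.
have tb : t * b <= t * (m + 1) by rewrite ler_wpM2l//; lra.
have ta : t * a <= t * (m + 1) by rewrite ler_wpM2l//; lra.
have up : s <= b * (1 + t) * N.
  apply: le_trans sK _; rewrite -mulrA ler_wpM2l//; apply: le_trans Kk _.
  by rewrite ler_wpM2l// addr_ge0.
have lo : a * (1 - t) * N <= s.
  apply: le_trans ks; rewrite -mulrA ler_wpM2l//.
  apply: (@le_trans _ _ ((1 - t) * ((1 + t) * k))).
    by rewrite ler_wpM2l ?subr_ge0//; apply: le_trans Kk.
  have : 0 <= t ^+ 2 * k by rewrite mulr_ge0 ?sqr_ge0// ltW.
  lra.
have up' : s / N <= b * (1 + t) by rewrite ler_pdivrMr.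
have lo' : a * (1 - t) <= s / N by rewrite ler_pdivlMr.
by apply/andP; split; lra.
Qed.

Lemma cvg_avg_of_geo {R : realType} (S : nat -> R) (m : R) :
  {homo S : i j / (i <= j)%N >-> i <= j} -> 0 <= S 0%N -> 0 <= m ->
  (forall q, (0 < q)%N -> S (geo q n) / (geo q n)%:R @[n --> \oo] --> m) ->
  S n / n%:R @[n --> \oo] --> m.
Proof.
move=> ndS S0 m0 Sgeo; apply/cvgrPdist_lt => e e0.
have Sn0 n : 0 <= S n by apply: le_trans S0 (ndS _ _ _).
have gp q n : 0 < (geo q n)%:R :> R by rewrite ltr0n geo_gt0.
pose t0 := Num.min 1 (e / (4 * (m + 1))).
have t00 : 0 < t0 by rewrite lt_min ltr01 divr_gt0// mulr_gt0// ltr_wpDl.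
pose q := (Num.bound (2 / t0)).+1.
have q0 : (0 < q)%N by [].
have q0R : 0 < q%:R :> R by rewrite ltr0n.
pose t : R := 2 / q%:R.
have t_ge0 : 0 <= t by rewrite divr_ge0.
have tt0 : t <= t0.
  rewrite ler_pdivrMr// -ler_pdivrMl// mulrC; apply: ltW.
  apply: lt_trans (archi_boundP _) _; first by rewrite divr_ge0// ltW.
  by rewrite ltr_nat.
have t1 : t <= 1 by apply: le_trans tt0 _; rewrite ge_min lexx.
have tm : t * (m + 1) <= e / 4.
  have -> : e / 4 = e / (4 * (m + 1)) * (m + 1) by field; rewrite gt_eqF// ltr_wpDl.
  rewrite ler_wpM2r ?addr_ge0//; apply: le_trans tt0 _.
  by rewrite ge_min lexx orbT.
pose del := Num.min 1 (e / 4).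
have del0 : 0 < del by rewrite lt_min ltr01 divr_gt0.
have del1 : del <= 1 by rewrite ge_min lexx.
have dele : del <= e / 4 by rewrite ge_min lexx orbT.
have [J _ aJ] : \forall n \near \oo, `|m - S (geo q n) / (geo q n)%:R| < del.
  by move/cvgrPdist_lt : (Sgeo q q0); apply.
near=> N.
have N0 : (0 < N)%N by near: N; exact: nbhs_infty_gt.
have [j /andP[kN Nk]] := geo_bracket q N N0.
(* Beyond [J] the averages at both ends are within [del] of [m]; beyond [q] the ratio bound [geo_ub]
   applies. *)
have Jj : (maxn J q <= j)%N.
  rewrite leqNgt; apply/negP => jJ.
  have : (geo q (maxn J q) <= N)%N by near: N; exact: nbhs_infty_ge.
  rewrite leqNgt => /negP; apply; apply: leq_trans Nk _.
  have ndg : {homo geo q : i j / (i <= j)%N >-> (i <= j)%N}.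
    by apply: homo_leq => [//|? ? ?|n]; [exact: leq_trans|exact: ltnW (geo_ltS q n)].
  exact: ndg.
have /andP[Jj' qj] : (J <= j)%N && (q <= j)%N by rewrite -geq_max.
have NR : 0 < N%:R :> R by rewrite ltr0n.
have rat := geo_ub (R := R) q j q0 qj.
have kNR : (geo q j)%:R <= N%:R :> R by rewrite ler_nat.
have NkR : N%:R <= (geo q j.+1)%:R :> R by rewrite ler_nat ltnW.
apply: (@average_squeeze _ (geo q j)%:R N%:R (geo q j.+1)%:R
  (S (geo q j) / (geo q j)%:R) _ (S (geo q j.+1) / (geo q j.+1)%:R)
  m del t e) => //.
- by rewrite divfK ?gt_eqF//; exact: ndS.
- by rewrite divfK ?gt_eqF//; apply: ndS; exact: ltnW.
- by rewrite divr_ge0.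
- by rewrite divr_ge0.
- exact: aJ.
- by apply: aJ; exact: leqW.
Unshelve. all: by end_near. Qed.

Lemma bounded_of_le {R : realType} {D : Type} (u : D -> R) (B : R) :
  (forall z, `|u z| <= B) -> [bounded u x | x in [set: D]].
Proof.
move=> uB; exists B; split; first exact: num_real.
by move=> y By z _; apply: le_trans (uB z) (ltW By).
Qed.

(** * Etemadi's strong law of large numbers for nonnegative functions of an i.i.d. sequence *)

Section iid.
Context {R : realType} {d d'} {Omega : measurableType d} {T : measurableType d'}.
Context (P : probability Omega R) (Y : nat -> {RV P >-> T})
  (mu : probability T R) (iidY : iid Y mu).

Lemma iid_integral i (f : T -> \bar R) : measurable_fun setT f ->
  (forall x, 0 <= f x)%E -> (\int[P]_w f (Y i w) = \int[mu]_x f x)%E.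
Proof.
move=> mf f0.
rewrite -(@eq_measure_integral _ _ _ _ mu (distribution P (Y i))); last first.
  by move=> A mA _; exact: iidY.2.
by rewrite ge0_integral_pushforward.
Qed.

(** Independence over the index set of [i] and [j] identifies the joint law with [mu \x mu] on
    rectangles, which determine a product measure. *)
Lemma iid_pair i j : i != j ->
  forall A, measurable A ->
  (pushforward P (fun w => (Y i w, Y j w)) A = (mu \x mu) A)%E.
Proof.
move=> ij A mA; apply/esym.
have mY : measurable_fun setT (fun w => (Y i w, Y j w)).
  exact: measurable_fun_pair.
apply: (@product_measure_unique _ _ _ _ _ mu mu
  (pushforward P (fun w => (Y i w, Y j w)))) => // {A mA} A B mA mB.
pose C k := if k == i then A else B.
have := iidY.1 [fset i; j]%fset C.
rewrite big_fsetU1 ?big_seq_fset1 ?inE//= /C eqxx eq_sym (negbTE ij).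
have dE k D : measurable D -> P (Y k @^-1` D) = mu D by move=> /(iidY.2 k) <-.
rewrite !dE// => <-; last by move=> k; case: ifP.
rewrite /pushforward; congr (P _); apply/seteqP; split => w /=.
  by move=> [Aw Bw] k /=; rewrite !inE => /orP[] /eqP ->;
    rewrite ?eqxx// eq_sym (negbTE ij).
move=> H; split.
- by have := H i; rewrite /= !inE !eqxx/=; exact.
- by have := H j; rewrite /= !inE eqxx orbT eq_sym (negbTE ij)/=; exact.
Qed.

(** Under the product law Fubini's theorem makes the inner integral [h x] times the vanishing mean;
    the bound [M] supplies integrability. *)
Lemma iid_uncorrelated i j (h : T -> R) (M : R) : i != j ->
  measurable_fun setT h -> (forall x, `|h x| <= M) ->
  (\int[mu]_x (h x)%:E = 0)%E ->
  (\int[P]_w (h (Y i w) * h (Y j w))%:E = 0)%E.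
Proof.
move=> ij mh hM h0.
pose g (z : T * T) := h z.1 * h z.2.
have mg : measurable_fun setT g.
  by apply: measurable_funM; apply: measurableT_comp.
have M0 : 0 <= M by apply: le_trans (hM point).
have gM z : `|g z| <= M * M by rewrite normrM ler_pM.
have mY : measurable_fun setT (fun w => (Y i w, Y j w)).
  exact: measurable_fun_pair.
rewrite -[LHS](@integral_pushforward _ _ _ _ _ _ mY P setT (EFin \o g))//; last 2 first.
- exact/measurable_EFinP.
- apply: (@measurable_bounded_integrable _ _ _ _ (fun w => g (Y i w, Y j w)) setT) => //.
  + exact: (le_lt_trans (probability_le1 P measurableT) (ltry _)).
  + exact: measurableT_comp.
  + by apply: (bounded_of_le _ (M * M)) => w; exact: gM.
rewrite (@eq_measure_integral _ _ _ _ (mu \x mu)%E); last first.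
  by move=> A mA _; exact: iid_pair.
have ig : (mu \x mu)%E.-integrable setT (EFin \o g).
  apply: measurable_bounded_integrable => //.
  + suff : (mu \x mu)%E setT = 1%E by move=> h1; rewrite (le_lt_trans _ (ltry 1))// -h1.
    rewrite -setXTT; transitivity (mu setT * mu setT)%E; first exact: product_measure1E.
    by rewrite (probability_setT mu) mule1.
  + by apply: (bounded_of_le _ (M * M)) => w; exact: gM.
rewrite -(integral12_prod_meas1 ig) /fubini_F.
have ih : mu.-integrable setT (EFin \o h).
  apply: measurable_bounded_integrable => //.
  + exact: (le_lt_trans (probability_le1 mu measurableT) (ltry _)).
  + exact: (bounded_of_le _ M).
under eq_integral => x _.
  under eq_integral => y _ do rewrite /g /= EFinM.
  rewrite integralZl// h0 mule0; over.
by rewrite integral0.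
Qed.


(** Uncorrelatedness leaves only the diagonal of the squared sum, so the variance of the average is
    that of [g] divided by [k], and a variance is at most the second moment. *)
Lemma iid_variance (g : T -> R) (K m : R) (k : nat) : (0 < k)%N ->
  measurable_fun setT g -> (forall x, 0 <= g x <= K) ->
  (\int[mu]_x (g x)%:E = m%:E)%E ->
  (\int[P]_w (((\sum_(i < k) g (Y i w)) / k%:R - m) ^+ 2)%:E <=
   \int[mu]_x (g x ^+ 2 / k%:R)%:E)%E.
Proof.
move=> k0 mg gK intg.
have g0 x : 0 <= g x by have /andP[] := gK x.
have k0R : (k%:R : R) != 0 by rewrite pnatr_eq0 -lt0n.
have m0 : 0 <= m by rewrite -lee_fin -intg; apply: integral_ge0 => x _; rewrite lee_fin.
pose h x := g x - m.
have mh : measurable_fun setT h by apply: measurable_funB.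
have hM x : `|h x| <= K + m.
  by have /andP[? ?] := gK x; rewrite /h ler_norml; apply/andP; split; lra.
have ig : mu.-integrable setT (EFin \o g).
  apply: measurable_bounded_integrable => //.
  + exact: (le_lt_trans (probability_le1 mu measurableT) (ltry _)).
  + by apply: (bounded_of_le _ K) => x; have /andP[? ?] := gK x; rewrite ger0_norm.
have h0 : (\int[mu]_x (h x)%:E = 0)%E.
  under eq_integral do rewrite /h EFinB.
  rewrite integralB_EFin//; last by apply: finite_measure_integrable_cst.
  by rewrite intg (probability_integral_cst mu) subee.
have mhY i : measurable_fun setT (fun w => h (Y i w)) by exact: measurableT_comp.
have ihh i j : P.-integrable setT (fun w => (h (Y i w) * h (Y j w))%:E).
  apply: (@measurable_bounded_integrable _ _ _ _ (fun w => h (Y i w) * h (Y j w)) setT) => //.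
  + exact: (le_lt_trans (probability_le1 P measurableT) (ltry _)).
  + exact: measurable_funM.
  + apply: (bounded_of_le _ ((K + m) * (K + m))) => w.
    by rewrite normrM ler_pM.
have E w : ((\sum_(i < k) g (Y i w)) / k%:R - m) ^+ 2 =
    k%:R ^- 2 * \sum_(i < k) \sum_(j < k) (h (Y i w) * h (Y j w)).
  under [in RHS]eq_bigr do rewrite -mulr_sumr.
  rewrite -mulr_suml /h sumrB sumr_const card_ord.
  by rewrite -mulr_natr; field.
have mhh : measurable_fun setT (fun x => (h x ^+ 2)%:E).
  by apply/measurable_EFinP/measurable_funX.
have mgg : measurable_fun setT (fun x => (g x ^+ 2)%:E).
  by apply/measurable_EFinP/measurable_funX.
(* This comes from integrating [h ^+ 2 + 2 * m * g = g ^+ 2 + m ^+ 2], whose terms are all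
   nonnegative, so that integrals add without subtraction. *)
have hg : (\int[mu]_x (h x ^+ 2)%:E <= \int[mu]_x (g x ^+ 2)%:E)%E.
  have : (\int[mu]_x ((h x ^+ 2)%:E + (2 * m * g x)%:E) =
          \int[mu]_x ((g x ^+ 2)%:E + (m ^+ 2)%:E))%E.
    by apply: eq_integral => x _; rewrite /h -!EFinD; congr (_%:E); ring.
  have sq (u : T -> R) x : setT x -> (0 <= (u x ^+ 2)%:E)%E by rewrite lee_fin sqr_ge0.
  have mg0 x : setT x -> (0 <= (2 * m * g x)%:E)%E by rewrite lee_fin !mulr_ge0.
  have mgE : measurable_fun setT (fun x => (2 * m * g x)%:E).
    by apply/measurable_EFinP; apply: measurable_funM.
  rewrite ge0_integralD//; [|exact: (sq h)].
  rewrite ge0_integralD//; [|exact: (sq g)|exact: (sq (cst m))].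
  rewrite (probability_integral_cst mu).
  under [X in (_ + X)%E = _]eq_integral do rewrite EFinM.
  rewrite ge0_integralZl_EFin ?mulr_ge0//; last 2 first.
  - by move=> x _; rewrite lee_fin.
  - exact/measurable_EFinP.
  rewrite intg -EFinM => H.
  have mm : (0 <= m ^+ 2) by rewrite sqr_ge0.
  rewrite -(leeD2rE (x := (2 * m * m)%:E))// H.
  apply: leeD => //; rewrite lee_fin; nra.
under eq_integral do rewrite E EFinM.
have isum i : P.-integrable setT (fun w => \sum_(j < k) (h (Y i w) * h (Y j w))%:E)%E.
  by apply: integrable_sum.
rewrite ge0_integralZl_EFin ?invr_ge0 ?sqr_ge0//; last 2 first.
- move=> w _; rewrite lee_fin; under eq_bigr do rewrite -mulr_sumr.
  by rewrite -mulr_suml -expr2 sqr_ge0.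
- apply/measurable_EFinP; apply: measurable_sum => i; apply: measurable_sum => j.
  exact: measurable_funM.
have -> : (\int[P]_w (\sum_(i < k) \sum_(j < k) (h (Y i w) * h (Y j w)))%:E =
    \sum_(i < k) \sum_(j < k) \int[P]_w (h (Y i w) * h (Y j w))%:E)%E.
  transitivity (\int[P]_w \sum_(i < k) \sum_(j < k) (h (Y i w) * h (Y j w))%:E)%E.
    by apply: eq_integral => w _; rewrite -sumEFin; apply: eq_bigr => i _; rewrite sumEFin.
  rewrite integral_sum//; apply: eq_bigr => i _.
  by rewrite integral_sum.
have -> : (\sum_(i < k) \sum_(j < k) \int[P]_w (h (Y i w) * h (Y j w))%:E =
   \sum_(i < k) \int[mu]_x (h x ^+ 2)%:E)%E.
  apply: eq_bigr => i _; rewrite (bigD1 i)//= big1 => [|j ji]; last first.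
    by apply: iid_uncorrelated mh hM h0; rewrite eq_sym.
  rewrite adde0 -(@iid_integral i (fun x => (h x ^+ 2)%:E))//.
  by move=> x; rewrite lee_fin sqr_ge0.
rewrite sumr_const card_ord.
under [X in (_ <= X)%E]eq_integral do rewrite mulrC EFinM.
rewrite ge0_integralZl_EFin ?invr_ge0//; last by move=> x _; rewrite lee_fin sqr_ge0.
rewrite -[X in (_ * X <= _)%E]mule_natl muleA -EFinM.
have -> : (k%:R ^- 2 * k%:R : R) = k%:R^-1 by field.
by apply: lee_wpmul2l; rewrite ?lee_fin ?invr_ge0.
Qed.


Lemma measurable_psi (k : R) : measurable_fun setT (@psi R k).
Proof.
apply: measurable_funD.
  apply: measurable_funM => //; apply: measurable_funX.
  exact: measurable_minr.
apply: measurable_funM => //.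
have -> : (fun z : R => (k < z)%R%:R) = \1_`]k, +oo[ :> (R -> R).
  apply/funext => z; rewrite indicE; congr (nat_of_bool _)%:R.
  by apply/idP/idP; rewrite inE/= in_itv/= andbT.
exact: measurable_indic.
Qed.

(** Truncation at [k n] leaves two errors, the fluctuation [A] of the truncated average and the
    count [B] of truncated observations. The expectation of [A ^+ 2 + B] is controlled by [psi],
    summable along [geo q], so both vanish almost surely; the truncated means [mn] tend to [m] by
    dominated convergence. *)
Lemma slln_geo (f : T -> R) (m : R) (q : nat) : (0 < q)%N ->
  measurable_fun setT f -> (forall x, 0 <= f x) ->
  (\int[mu]_x (f x)%:E = m%:E)%E ->
  {ae P, forall w, (\sum_(i < geo q n) f (Y i w)) / (geo q n)%:R
    @[n --> \oo] --> m}.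
Proof.
move=> q0 mf f0 intf.
pose k n : R := (geo q n)%:R.
have k0 n : 0 < k n by rewrite ltr0n geo_gt0.
pose g n x := Num.min (f x) (k n).
have mg n : measurable_fun setT (g n) by apply: measurable_minr.
have gK n x : 0 <= g n x <= k n by rewrite /g le_min f0 ge_min lexx orbT ltW.
have gf n x : 0 <= g n x <= f x by rewrite /g le_min f0 ge_min lexx ltW ?k0.
have mfE : measurable_fun setT (fun x => (f x)%:E) by exact/measurable_EFinP.
have mgE n : measurable_fun setT (fun x => (g n x)%:E) by exact/measurable_EFinP.
have intf_fin : mu.-integrable setT (fun x => (f x)%:E).
  apply/integrableP; split=> //.
  by under eq_integral do rewrite gee0_abs ?lee_fin//; rewrite intf ltry.
pose mn n := fine (\int[mu]_x (g n x)%:E).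
have intg n : (\int[mu]_x (g n x)%:E = (mn n)%:E)%E.
  rewrite /mn fineK// ge0_fin_numE; last first.
    by apply: integral_ge0 => x _; rewrite lee_fin; case/andP: (gK n x).
  apply: le_lt_trans (ltry m); rewrite -intf; apply: ge0_le_integral => //.
  - by move=> x _; rewrite lee_fin; case/andP: (gf n x).
  - by move=> x _; rewrite lee_fin; case/andP: (gf n x).
have mn_cvg : mn n @[n --> \oo] --> m.
  suff : (\int[mu]_x (g n x)%:E)%E @[n --> \oo] --> m%:E.
    by under eq_cvg do rewrite intg; move/fine_cvgP => [].
  rewrite -intf; apply: (dominated_cvg measurableT (g := fun x => (f x)%:E)) => //.
  - move=> x _; apply: cvg_near_cst.
    near=> n; congr (_%:E); rewrite /g min_l//.
    apply: le_trans (ltW (archi_boundP (f0 x))) _.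
    rewrite ler_nat; apply: leq_trans (leq_geo q n).
    by near: n; exact: nbhs_infty_ge.
  - by move=> n x _; rewrite lee_fin; case/andP: (gf n x) => ? ?; rewrite ger0_norm.
pose ind n x : R := (k n < f x)%R%:R.
have mind n : measurable_fun setT (ind n).
  rewrite (_ : ind n = \1_`]k n, +oo[ \o f).
    by apply: measurableT_comp => //; exact: measurable_indic.
  apply/funext => x; rewrite /ind /= indicE; congr (nat_of_bool _)%:R.
  by apply/idP/idP; rewrite inE/= in_itv/= andbT.
pose A n w := (\sum_(i < geo q n) g n (Y i w)) / k n - mn n.
pose B n w := \sum_(i < geo q n) ind n (Y i w).
pose W n w := A n w ^+ 2 + B n w.
have mA n : measurable_fun setT (fun w => A n w ^+ 2).
  apply: measurable_funX; apply: measurable_funB => //; apply: measurable_funM => //.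
  by apply: measurable_sum => i; exact: measurableT_comp.
have mB n : measurable_fun setT (B n).
  by apply: measurable_sum => i; exact: measurableT_comp.
have B0 n w : 0 <= B n w by rewrite sumr_ge0// => i _; rewrite /ind ler0n.
have psi0 n x : 0 <= psi (k n) (f x).
  have kn := ltW (k0 n); rewrite /psi; apply: addr_ge0; first by rewrite divr_ge0 ?sqr_ge0.
  exact: mulr_ge0.
have mpsi n : measurable_fun setT (fun x => (psi (k n) (f x))%:E).
  by apply/measurable_EFinP; apply: measurableT_comp (measurable_psi _) mf.
(* The variance bound accounts for the first summand of [psi], identical distribution of the
   [geo q n] terms for the second. *)
have intW n : (\int[P]_w (W n w)%:E <= \int[mu]_x (psi (k n) (f x))%:E)%E.
  under eq_integral do rewrite EFinD.
  rewrite ge0_integralD//=; last 4 first.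
  - by move=> w _; rewrite lee_fin sqr_ge0.
  - exact/measurable_EFinP.
  - by move=> w _; rewrite lee_fin.
  - exact/measurable_EFinP.
  under [leRHS]eq_integral do rewrite EFinD.
  rewrite ge0_integralD//=; last 4 first.
  - by move=> x _; rewrite lee_fin; exact: (divr_ge0 (sqr_ge0 _) (ltW (k0 n))).
  - apply/measurable_EFinP; apply: measurable_funM => //; exact: (measurable_funX _ (mg n)).
  - by move=> x _; rewrite lee_fin; exact: (mulr_ge0 (ltW (k0 n)) (ler0n _ _)).
  - by apply/measurable_EFinP; apply: measurable_funM => //; exact: mind.
  apply: leeD.
    exact: iid_variance (geo_gt0 q n) (mg n) (gK n) (intg n).
  under eq_integral do rewrite -sumEFin.
  rewrite ge0_integral_sum//; last 2 first.
  - by move=> i; apply/measurable_EFinP; exact: measurableT_comp.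
  - by move=> i w _; rewrite lee_fin.
  rewrite (eq_bigr (fun=> \int[mu]_x (ind n x)%:E)%E); last first.
    move=> i _; apply: (@iid_integral _ (fun x => (ind n x)%:E)) => [|x].
      exact/measurable_EFinP.
    by rewrite lee_fin ler0n.
  rewrite sumr_const card_ord.
  under [leRHS]eq_integral do rewrite EFinM.
  rewrite ge0_integralZl_EFin//; last first.
    by apply/measurable_EFinP; exact: mind.
  by rewrite mule_natl.
have sumW N : (\sum_(0 <= n < N) \int[P]_w (W n w)%:E <=
    (4 * (2 * q%:R + 1) * m)%:E)%E.
  apply: (@le_trans _ _ (\sum_(0 <= n < N) \int[mu]_x (psi (k n) (f x))%:E)%E).
    by apply: lee_sum => n _; exact: intW.
  rewrite -ge0_integral_sum//; last first.
    by move=> n x _; rewrite lee_fin.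
  have c0 : 0 <= 4 * (2 * q%:R + 1) :> R by rewrite mulr_ge0// addr_ge0// mulr_ge0.
  rewrite EFinM -intf -ge0_integralZl_EFin//; last by move=> x _; rewrite lee_fin.
  apply: ge0_le_integral => //.
  - by move=> x _; apply: sume_ge0 => n _; rewrite lee_fin.
  - exact: emeasurable_sum.
  - by apply/measurable_EFinP; apply: measurable_funM.
  - by move=> x _; rewrite sumEFin -EFinM lee_fin sum_psi_le.
have W0 n w : 0 <= W n w by rewrite addr_ge0 ?sqr_ge0.
have mW n : measurable_fun setT (W n) by apply: measurable_funD.
have := ae_cvg0_of_summable P W _ mW W0 sumW.
apply: filterS => w Ww.
(* Since [B] is a count, [W < 1] forces it to be zero, so eventually no observation is truncated. *)
have avgE : \forall n \near \oo,
    (\sum_(i < geo q n) f (Y i w)) / (geo q n)%:R = A n w + mn n.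
  have : \forall n \near \oo, `|0 - W n w| < 1.
    by move/cvgrPdist_lt : Ww; apply.
  apply: filterS => n; rewrite sub0r normrN ger0_norm// => W1.
  rewrite /A subrK; congr (_ / _); apply: eq_bigr => i _.
  rewrite /g min_l// leNgt; apply/negP => kf.
  have : B n w < 1 by apply: le_lt_trans W1; rewrite lerDr sqr_ge0.
  rewrite ltNge => /negP; apply; rewrite /B (bigD1 i)//= /ind kf lerDl.
  by rewrite sumr_ge0.
apply: (@cvg_trans _ ((fun n => A n w + mn n) @ \oo)).
  by apply: near_eq_cvg; apply: filterS avgE => n ->.
rewrite -[m]add0r; apply: cvgD => //.
apply/cvgrPdist_lt => e e0.
have : \forall n \near \oo, `|0 - W n w| < e ^+ 2.
  by move/cvgrPdist_lt : Ww; apply; rewrite exprn_gt0.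
apply: filterS => n; rewrite !sub0r !normrN ger0_norm// => We.
have : `|A n w| ^+ 2 < e ^+ 2.
  by rewrite real_normK ?num_real//; apply: le_lt_trans We; rewrite lerDl.
by rewrite ltr_pXn2r// ?nnegrE// ltW.
Unshelve. all: by end_near. Qed.

(** One almost sure event serves all growth parameters, and since [f] is nonnegative the partial
    sums are monotone, as interpolation requires. *)
Theorem slln (f : T -> R) (m : R) :
  measurable_fun setT f -> (forall x, 0 <= f x) ->
  (\int[mu]_x (f x)%:E = m%:E)%E ->
  {ae P, forall w, (\sum_(i < n.+1) f (Y i w)) / n.+1%:R @[n --> \oo] --> m}.
Proof.
move=> mf f0 intf.
have m0 : 0 <= m.
  by rewrite -lee_fin -intf; apply: integral_ge0 => x _; rewrite lee_fin.
have : {ae P, forall w, forall q, (\sum_(i < geo q.+1 n) f (Y i w)) /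
    (geo q.+1 n)%:R @[n --> \oo] --> m}.
  by apply/ae_foralln => q; exact: slln_geo.
apply: filterS => w Hw.
pose S n := \sum_(i < n) f (Y i w).
rewrite (@cvg_shiftS _ (fun n => S n / n%:R)).
apply: (cvg_avg_of_geo S) => //; last 2 first.
- by rewrite /S sumr_ge0.
- by case=> // q _; exact: Hw.
apply: homo_leq => [//|? ? ?|n]; first exact: le_trans.
by rewrite /S big_ord_recr/= lerDl.
Qed.

End iid.

(** * A criterion for convergence in the join of the two hyperspace topologies *)

Section hyperspace.
Context {R : realType} {X : pointedMetricType R}.

(** The upper condition yields the miss sets of the Fell topology, with [U] the complement of a
    compact set, and also smallness of the excess, with [U] a union of balls about [B]. The lower
    condition yields the hit sets. *)
Lemma cvg_fell_upper_hausdorffP (A : nat -> set X) (B : set X) :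
  (forall n, A n !=set0) -> (forall n, compact (A n)) ->
  B !=set0 -> compact B ->
  (forall U, open U -> B `<=` U -> \forall n \near \oo, A n `<=` U) ->
  (forall U, open U -> B `&` U !=set0 -> \forall n \near \oo, A n `&` U !=set0) ->
  cvg_fell_upper_hausdorff A B.
Proof.
move=> A0 cA B0 cB AU AL.
exists (fun n => Compacts (A0 n) (cA n)), (Compacts B0 cB); split => //.
apply/cvg_sup => -[].
- move=> U /=; rewrite (@nbhsE (fell X)) => -[V [[/= Vs sub <-] [W VW WB]]] sVU.
  apply: filterS sVU _; apply: (@filterS _ _ _ W).
    by move=> C WC; exists W.
  have /sub [D Dsub DW] := VW; rewrite -DW.
  apply: filter_bigI => E DE; have /Dsub := DE; rewrite inE => sE.
  have EB : E (Compacts B0 cB) by move: WB; rewrite -DW; apply.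
  case: sE EB => -[K oK <-] /=.
    exact: AL.
  move=> BK.
  have := AU (~` K); rewrite openC.
  have cK : closed K by apply: compact_closed => //; exact: metric_hausdorff.
  move=> /(_ cK); rewrite -disjoints_subset => /(_ BK).
  by apply: filterS => n AnK /=; rewrite disjoints_subset.
- move=> U /=; rewrite (@nbhsE (upper_hausdorff X)) => -[V [oV VB]] sVU.
  apply: filterS sVU _.
  have [e e0 eV] := oV _ VB.
  (* Radius [e / 2], because the supremum in [excess] inherits only a weak inequality. *)
  have /AU : open (\bigcup_(b in B) (ball b (e / 2))^°).
    by apply: bigcup_open => b _; exact: open_interior.
  have BU : B `<=` \bigcup_(b in B) (ball b (e / 2))^°.
    by move=> b Bb; exists b => //; apply: nbhsx_ballx; rewrite divr_gt0.
  move=> /(_ BU); apply: filterS => n An; apply: eV => /=.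
  rewrite /excess /=; apply: (@le_lt_trans _ _ (e / 2)); last first.
    by rewrite ltr_pdivrMr// ltr_pMr// ltr1n.
  apply: sup_le_ub.
    by have [a Aa] := A0 n; exists (inf [set mdist a x' | x' in B]); exists a.
  move=> _ [a Aa <-]; have [b Bb /interior_subset] := An a Aa.
  rewrite ballEmdist/= metric_sym => ab.
  apply: le_trans (ltW ab); apply: ge_inf; last by exists b.
  by exists 0 => _ [c _ <-]; exact: mdist_ge0.
Qed.

End hyperspace.

(** * Minimisers of 1-Lipschitz functions on Heine-Borel spaces *)

Section argmin.
Context {R : realType} {X : pointedMetricType R}.
Implicit Types (S : set X) (G : X -> R).

Definition argmin S G : set X :=
  [set x | S x /\ forall x', S x' -> G x <= G x'].

Definition nonexpansive G := forall x y, G x <= G y + mdist x y.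

(** A coercivity condition: it bounds the diameter of the sublevel set at [c] by [2 * c], so that
    the Heine-Borel property gives compactness. *)
Definition distance_bounding G := forall x y, mdist x y <= G x + G y.

Lemma nonexpansive_continuous G : nonexpansive G -> continuous G.
Proof.
move=> lipG x; apply/cvgrPdist_lt => e e0; near=> y.
have xy : mdist x y < e.
  have : ball x e y by near: y; exact: nbhsx_ballx.
  by rewrite ballEmdist.
have := lipG x y; have := lipG y x; rewrite [mdist y x]metric_sym => h1 h2.
by rewrite ltr_norml; apply/andP; split; lra.
Unshelve. all: by end_near. Qed.

Lemma mdist_nonexpansive (z : X) : nonexpansive (mdist z).
Proof. by move=> x y; have := metric_triangle z y x; rewrite (metric_sym y x). Qed.

Lemma closed_sublevel G (c : R) : nonexpansive G -> closed [set x | G x <= c].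
Proof.
move=> /nonexpansive_continuous cG.
by have := (continuous_closedP G).1 cG _ (@closed_le R c).
Qed.

Lemma compact_sublevel S G (c : R) : heine_borel X -> closed S ->
  nonexpansive G -> distance_bounding G -> compact (S `&` [set x | G x <= c]).
Proof.
move=> hX cS lipG bdG; apply: hX.
  by apply: closedI => //; exact: closed_sublevel.
exists (c + c) => x y [_ xc] [_ yc]; apply: le_trans (bdG x y) _; exact: lerD.
Qed.

Lemma argmin_nonempty S G : heine_borel X -> closed S -> S !=set0 ->
  nonexpansive G -> distance_bounding G -> argmin S G !=set0.
Proof.
move=> hX cS [s Ss] lipG bdG.
have cK := compact_sublevel S G (G s) hX cS lipG bdG.
have [||c] := @compact_EVT_min _ _ G _ _ cK.
- by exists s; split => //=.
- exact/continuous_subspaceT/nonexpansive_continuous.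
rewrite inE => -[Sc /= cs] cmin; exists c; split => // x Sx.
have [xs|/ltW] := leP (G x) (G s); last exact: le_trans.
by apply: cmin; rewrite inE.
Qed.

Lemma argmin_compact S G : heine_borel X -> closed S ->
  nonexpansive G -> distance_bounding G -> compact (argmin S G).
Proof.
move=> hX cS lipG bdG.
have [[c [Sc cmin]]|] := pselect (argmin S G !=set0); last first.
  by move/set0P/negP/negPn/eqP => ->; exact: compact0.
suff -> : argmin S G = S `&` [set x | G x <= G c] by exact: compact_sublevel.
apply/seteqP; split => x [Sx xmin]; split => //=; first exact: xmin.
by move=> y Sy; apply: le_trans xmin (cmin y Sy).
Qed.

(** For large [n], minimisers outside [U] would lie in a compact set [B] on which [G] exceeds its
    minimum over [S]. Around each point of [B], some point of [Sn n] near [x0] eventually has a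
    smaller value of [Gn n]; compactness makes this uniform over [B]. *)
Lemma argmin_eventually_sub (Sn : nat -> set X) S (Gn : nat -> X -> R) G
    (x0 : X) (U : set X) :
  heine_borel X -> closed S -> (forall n, Sn n `<=` S) -> argmin S G x0 ->
  (forall e, 0 < e ->
     \forall n \near \oo, exists2 s, Sn n s & mdist s x0 < e) ->
  nonexpansive G -> (forall n, nonexpansive (Gn n)) ->
  (forall n, distance_bounding (Gn n)) ->
  (forall z, Gn n z @[n --> \oo] --> G z) ->
  open U -> argmin S G `<=` U ->
  \forall n \near \oo, argmin (Sn n) (Gn n) `<=` U.
Proof.
move=> hX cS SnS [Sx0 minx0] hit lipG lipGn bdGn GnG oU GU.
pose m := G x0.
have near_bound z e : 0 < e -> \forall n \near \oo, `|G z - Gn n z| < e.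
  by move=> e0; move/cvgrPdist_lt : (GnG z); apply.
(* The radius: eventually [Gn n x0 < m + 1] and a minimiser has value below [m + 2], and the sum of
   the two values bounds its distance to [x0]. *)
pose B := S `&` [set z | mdist x0 z <= 2 * m + 3] `&` ~` U.
have cB : compact B.
  apply: hX.
    apply: closedI; last exact: open_closedC.
    by apply: closedI => //; apply: closed_sublevel; exact: mdist_nonexpansive.
  exists (2 * (2 * m + 3)) => x y [[_ /= x1] _] [[_ /= y1] _].
  have := metric_triangle x x0 y; rewrite (metric_sym x x0); lra.
have beaten z : B z -> \forall z' \near z & n \near \oo,
    exists2 s, Sn n s & Gn n s < Gn n z'.
  move=> [[Sz _] Uz].
  have mz : m < G z.
    rewrite ltNge; apply/negP => zm; apply: Uz; apply: GU; split => // x Sx.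
    exact: le_trans (minx0 x Sx).
  (* With this gap [Gn n s < m + 2 * e] while [Gn n z' > m + 3 * e]. *)
  pose e := (G z - m) / 5.
  have e0 : 0 < e by rewrite divr_gt0// subr_gt0.
  have zE : G z = m + 5 * e by rewrite /e; field.
  near=> z' n.
  have zz' : mdist z z' < e.
    have : ball z e z' by near: z'; exact: nbhsx_ballx.
    by rewrite ballEmdist.
  have [s Ss sx0] : exists2 s, Sn n s & mdist s x0 < e.
    by near: n; exact: hit.
  have gz : `|G z - Gn n z| < e by near: n; exact: near_bound.
  have gx : `|G x0 - Gn n x0| < e by near: n; exact: near_bound.
  exists s => //; move: gz gx; rewrite !ltr_norml => /andP[? ?] /andP[? ?].
  have := lipGn n s x0; have := lipGn n z z'.
  move: zE; rewrite /m; clearbody e; lra.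
have cov := (compact_near_coveringP B).1 cB nat \oo
  (fun n z => exists2 s, Sn n s & Gn n s < Gn n z) _ beaten.
near=> n => z [Snz minz]; apply: contrapT => Uz.
have [s Ss sx0] : exists2 s, Sn n s & mdist s x0 < 1.
  by near: n; exact: hit.
have gx : `|G x0 - Gn n x0| < 1 by near: n; exact: near_bound.
have Bz : B z.
  split => //; split => /=; first exact: SnS Snz.
  have := minz s Ss; have := lipGn n s x0; have := bdGn n x0 z.
  move: gx; rewrite !ltr_norml => /andP[? ?]; rewrite /m; lra.
have [s' Ss'] : exists2 s, Sn n s & Gn n s < Gn n z.
  by move: z Bz {Snz minz Uz}; near: n; exact: cov.
by rewrite ltNge minz.
Unshelve. all: by end_near. Qed.

Lemma nonexpansive_cvg (D : nat -> X) (Gn : nat -> X -> R) G :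
  (forall x e, 0 < e -> exists n, mdist x (D n) < e) ->
  nonexpansive G -> (forall n, nonexpansive (Gn n)) ->
  (forall j, Gn n (D j) @[n --> \oo] --> G (D j)) ->
  forall z, Gn n z @[n --> \oo] --> G z.
Proof.
move=> dD lipG lipGn GD z; apply/cvgrPdist_lt => e e0.
have e3 : 0 < e / 3 by rewrite divr_gt0.
have [j zj] := dD z _ e3.
have : \forall n \near \oo, `|G (D j) - Gn n (D j)| < e / 3.
  by move/cvgrPdist_lt : (GD j); apply.
apply: filterS => n; rewrite !ltr_norml => /andP[? ?].
have := lipG z (D j); have := lipG (D j) z.
have := lipGn n z (D j); have := lipGn n (D j) z.
rewrite (metric_sym (D j) z) => *; apply/andP; split; lra.
Qed.

(** Closed balls about [point] are compact and so have finite nets of every mesh; the nets for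
    integer radii and meshes [1 / (k + 1)] form a countable set. *)
Lemma heine_borel_dense_seq : heine_borel X ->
  exists D : nat -> X, forall x e, 0 < e -> exists n, mdist x (D n) < e.
Proof.
move=> hX.
have net (nk : nat * nat) : exists s : seq X, forall x,
    mdist point x <= nk.1%:R -> exists2 y, y \in s & mdist x y < nk.2.+1%:R^-1.
  case: nk => n k /=.
  have cK : compact [set x : X | mdist point x <= n%:R].
    apply: hX; first by apply: closed_sublevel; exact: mdist_nonexpansive.
    exists (n%:R + n%:R) => x y /= xn yn.
    by apply: le_trans (metric_triangle x point y) _; rewrite lerD// metric_sym.
  rewrite compact_cover in cK.
  have [y _|x _|s _ cov] := cK X setT (fun y => (ball y k.+1%:R^-1)^°).
  - exact: open_interior.
  - by exists x => //; apply: nbhsx_ballx; rewrite invr_gt0.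
  exists (enum_fset s) => x /cov[y ys /interior_subset].
  by rewrite ballEmdist/= metric_sym => ?; exists y.
have [s sP] := choice net.
(* The sequence decodes its index into radius, mesh and position in the net; indices that encode
   nothing fall back to [point]. *)
exists (fun c => if (choice.unpickle c : option (nat * nat * nat)) is Some (n, k, j)
  then nth point (s (n, k)) j else point).
move=> x e e0.
pose n := Num.bound (mdist point x); pose k := Num.bound e^-1.
have [y ys xy] : exists2 y, y \in s (n, k) & mdist x y < k.+1%:R^-1.
  by apply: (sP (n, k)) => /=; apply/ltW/archi_boundP/mdist_ge0.
exists (choice.pickle (n, k, index y (s (n, k)))); rewrite choice.pickleK nth_index//.
apply: lt_trans xy _; rewrite invf_plt ?posrE//.
apply: lt_trans (archi_boundP _) _; first by rewrite invr_ge0 ltW.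
by rewrite ltr_nat.
Qed.

End argmin.

(** * The root of the Frechet functional as a norm *)

(** Monotonicity of the norm followed by Minkowski's inequality. It serves the triangle inequalities
    between [mdist x], [mdist y] and the constant [mdist x y], whose norm under a probability is
    itself. *)
Lemma Lnorm_le_add {R : realType} {d} {T : measurableType d}
    (mu : {measure set T -> \bar R}) (p : R) (f g h : T -> R) : 1 <= p ->
  measurable_fun setT f -> measurable_fun setT g -> measurable_fun setT h ->
  (forall x, 0 <= f x <= g x + h x) ->
  ('N[mu]_p%:E[EFin \o f] <= 'N[mu]_p%:E[EFin \o g] + 'N[mu]_p%:E[EFin \o h])%E.
Proof.
move=> p1 mf mg mh fgh; have p0 : 0 <= p by apply: le_trans p1.
apply: le_trans (minkowski_EFin mu mg mh p1).
have mpow (u : T -> R) : measurable_fun setT u ->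
    measurable_fun setT (fun x => (`|(EFin \o u) x| `^ p)%E).
  move=> mu'.
  rewrite (_ : (fun x => _) = (fun x => (`|u x| `^ p)%:E)); last first.
    by apply/funext => x /=; rewrite -poweR_EFin -abse_EFin.
  apply/measurable_EFinP.
  apply: (measurableT_comp (f := fun x : R => x `^ p)) => //.
  exact: measurableT_comp.
rewrite unlock; apply: gt0_ler_poweR.
- by rewrite invr_ge0.
- by rewrite in_itv/= leey andbT integral_ge0// => x _; rewrite poweR_ge0.
- by rewrite in_itv/= leey andbT integral_ge0// => x _; rewrite poweR_ge0.
have mf' := mpow _ mf; have mgh' := mpow _ (measurable_funD mg mh).
have ge0 (u : T -> R) x : setT x -> (0 <= `|(EFin \o u) x| `^ p)%E.
  by rewrite poweR_ge0.
apply: ge0_le_integral; [exact: measurableT|exact: ge0|exact: mf'|exact: mgh'|].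
move=> x _; have /andP[f0 fle] := fgh x.
apply: gt0_ler_poweR => //=; rewrite ?in_itv/= ?leey ?andbT ?abse_ge0//.
by rewrite lee_fin !ger0_norm// (le_trans f0).
Qed.

Section frechet.
Context {R : realType} {X : pointedMetricType R}.

Lemma open_measurable_borel (U : set X) : open U -> measurable (U : set (borel X)).
Proof. exact: sub_sigma_algebra. Qed.

Lemma measurable_mdist (z : X) :
  measurable_fun setT (fun y : borel X => mdist z (y : X)).
Proof.
move=> mD; apply: (measurability _ (RGenOpens.measurableE R)) => //.
move=> _ [_ [a [b ->]] <-]; rewrite setTI; apply: open_measurable_borel.
have /continuousP := nonexpansive_continuous _ (mdist_nonexpansive z).
by apply; exact: interval_open.
Qed.

Lemma measurable_mdist_powR (p : R) (z : X) :
  measurable_fun setT (fun y : borel X => mdist z (y : X) `^ p).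
Proof.
apply: (measurableT_comp (f := fun x : R => x `^ p)) => //.
exact: measurable_mdist.
Qed.

Context (p : R) (nu : {measure set (borel X) -> \bar R})
  (p1 : 1 <= p) (nu1 : nu setT = 1%E) (fin : finite_moment p nu).

Let p0 : 0 < p. Proof. exact: lt_le_trans p1. Qed.

(* The [p]-th root of the Frechet functional, which unlike the functional
   itself is 1-Lipschitz by Minkowski's inequality. *)
Definition frechet_root (z : X) : R :=
  fine ('N[nu]_p%:E[EFin \o (fun y : borel X => mdist z (y : X))])%E.

Lemma frechet_functional_fin_num z : frechet_functional p nu z \is a fin_num.
Proof.
rewrite ge0_fin_numE; first exact: fin.
by apply: integral_ge0 => y _; rewrite lee_fin powR_ge0.
Qed.

Lemma frechet_functional_Lnorm z : (frechet_functional p nu z =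
  'N[nu]_p%:E[EFin \o (fun y : borel X => mdist z (y : X))] `^ p)%E.
Proof.
rewrite [RHS]poweR_Lnorm; last by rewrite gt_eqF.
rewrite /frechet_functional; apply: eq_integral => y _.
rewrite [RHS](_ : _ = ((`|mdist z (y : X)| `^ p)%:E))//.
by rewrite ger0_norm// mdist_ge0.
Qed.

Lemma Lnorm_mdist z :
  ('N[nu]_p%:E[EFin \o (fun y : borel X => mdist z (y : X))] =
   (frechet_root z)%:E)%E.
Proof.
rewrite /frechet_root fineK//.
have := frechet_functional_fin_num z; rewrite frechet_functional_Lnorm.
rewrite !ge0_fin_numE ?poweR_ge0 ?Lnorm_ge0//.
by apply: lty_poweRy; rewrite gt_eqF.
Qed.

Lemma frechet_root_ge0 z : 0 <= frechet_root z.
Proof. by rewrite fine_ge0// Lnorm_ge0. Qed.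

Lemma frechet_functionalE z :
  frechet_functional p nu z = (frechet_root z `^ p)%:E.
Proof. by rewrite frechet_functional_Lnorm Lnorm_mdist poweR_EFin. Qed.

Lemma frechet_rootE z : frechet_root z = fine (frechet_functional p nu z) `^ p^-1.
Proof.
rewrite frechet_functionalE /= -powRrM mulfV ?gt_eqF// powRr1//.
exact: frechet_root_ge0.
Qed.

Lemma Lnorm_cst_prob (r : R) : 0 <= r ->
  ('N[nu]_p%:E[EFin \o (cst r : borel X -> R)] = r%:E)%E.
Proof.
move=> r0; rewrite unlock.
rewrite (eq_integral (cst (r `^ p)%:E)) => [|x _]; last first.
  by rewrite /= ger0_norm.
by rewrite integral_cst// nu1 mule1 poweR_EFin -powRrM mulfV ?gt_eqF// powRr1.
Qed.

Lemma frechet_root_nonexpansive : nonexpansive frechet_root.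
Proof.
move=> x y; rewrite -lee_fin EFinD -(Lnorm_mdist x) -(Lnorm_mdist y).
rewrite -(Lnorm_cst_prob _ (mdist_ge0 x y)).
apply: Lnorm_le_add => //; [exact: measurable_mdist|exact: measurable_mdist|].
by move=> z; rewrite mdist_ge0 addrC metric_triangle.
Qed.

Lemma frechet_root_distance_bounding : distance_bounding frechet_root.
Proof.
move=> x y; rewrite -lee_fin EFinD -(Lnorm_mdist x) -(Lnorm_mdist y).
rewrite -(Lnorm_cst_prob _ (mdist_ge0 x y)).
apply: Lnorm_le_add => //; [exact: measurable_mdist|exact: measurable_mdist|].
by move=> z; rewrite mdist_ge0 (metric_sym y) metric_triangle.
Qed.

Lemma le_frechet_root x y : (frechet_functional p nu x <=
  frechet_functional p nu y)%E = (frechet_root x <= frechet_root y).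
Proof.
rewrite !frechet_functionalE lee_fin; apply/idP/idP; last first.
  by apply: ge0_ler_powR; rewrite ?nnegrE ?frechet_root_ge0// ltW.
apply: contraTT; rewrite -!ltNge.
by apply: gt0_ltr_powR; rewrite ?nnegrE ?frechet_root_ge0.
Qed.

Lemma frechet_mean_argmin : frechet_mean p nu = argmin setT frechet_root.
Proof.
apply/seteqP; split => [x xmin|x [_ xmin] y]; last by rewrite le_frechet_root xmin.
by split => // y _; rewrite -le_frechet_root; exact: xmin.
Qed.

Lemma restricted_frechet_mean_argmin :
  restricted_frechet_mean p nu = argmin (msupport nu) frechet_root.
Proof.
apply/seteqP; split => x [xs xmin]; (split; first exact: xs) => y ys.
  by rewrite -le_frechet_root; exact: xmin.
by rewrite le_frechet_root; exact: xmin.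
Qed.

Lemma closed_msupport : closed (msupport nu).
Proof.
move=> x xcl U oU Ux.
have [y [ys Uy]] := xcl U (open_nbhs_nbhs (conj oU Ux)).
exact: ys.
Qed.

End frechet.

(** * Empirical measures and continuity of powers *)

Section empirical.
Context {R : realType} {X : pointedMetricType R}.
Context (y : nat -> borel X) (n : nat).

Lemma empirical_setT : empirical y n.+1 setT = 1%E.
Proof.
rewrite /empirical /= /mscale /= /msum /=.
under eq_bigr do rewrite diracT.
by rewrite sumEFin sumr_const card_ord -EFinM mulVf ?pnatr_eq0.
Qed.

Lemma frechet_functional_empirical (p : R) z :
  frechet_functional p (empirical y n.+1) z =
  ((\sum_(i < n.+1) mdist z (y i : X) `^ p) / n.+1%:R)%:E.
Proof.
have mz : measurable_fun setT (fun x : borel X => (mdist z (x : X) `^ p)%:E).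
  by apply/measurable_EFinP; exact: measurable_mdist_powR.
have z0 (x : borel X) : setT x -> (0 <= (mdist z (x : X) `^ p)%:E)%E.
  by rewrite lee_fin powR_ge0.
rewrite /frechet_functional ge0_integral_mscale// ge0_integral_measure_sum//.
under eq_bigr do rewrite integral_dirac// diracT mul1e.
by rewrite sumEFin /= -EFinM mulrC.
Qed.

Lemma finite_moment_empirical (p : R) : finite_moment p (empirical y n.+1).
Proof. by move=> z; rewrite frechet_functional_empirical ltry. Qed.

(** Every sample point carries mass at least [1 / (n + 1)], and the complement of the finite sample
    is open and null. *)
Lemma msupport_empirical :
  msupport (empirical y n.+1) = [set (y i : X) | i in `I_n.+1].
Proof.
have emp U : empirical y n.+1 U = (n.+1%:R^-1%:E * \sum_(i < n.+1) \d_(y i) U)%E by [].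
apply/seteqP; split => [x xs|_ [i iN <-] U _ Ui]; last first.
  rewrite emp mule_gt0 ?lte_fin ?invr_gt0//.
  rewrite (bigD1 (Ordinal iN))//= diracE mem_set//.
  by rewrite (@lt_le_trans _ _ 1%E) ?lte01// leeDl// sume_ge0.
apply: contrapT => xY.
have cY : @closed X [set (y i : X) | i in `I_n.+1].
  have aX : accessible_space X.
    by apply: hausdorff_accessible; exact: metric_hausdorff.
  have [acc _] := @accessible_finite_set_closed X.
  exact: acc aX _ (finite_image _ (finite_II _)).
have := xs _ (closed_openC cY) xY; rewrite emp big1 ?mule0 ?ltxx// => i _.
rewrite diracE memNset//= => nY; apply: nY.
by exists i => //=.
Qed.

End empirical.

(** Powers are monotone on nonnegative reals, so [u n] need only be compared with the [r]-th roots
    of the endpoints of the target interval; a negative lower endpoint is passed trivially. *)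
Lemma cvg_powR_base {R : realType} (u : nat -> R) (l r : R) : 0 < r -> 0 <= l ->
  (forall n, 0 <= u n) -> u n @[n --> \oo] --> l ->
  u n `^ r @[n --> \oo] --> l `^ r.
Proof.
move=> r0 l0 u0 ul; apply/cvgrPdist_lt => e e0.
have g0 : 0 <= l `^ r by exact: powR_ge0.
have rootK (a : R) : 0 <= a -> (a `^ r^-1) `^ r = a.
  by move=> a0; rewrite -powRrM mulVf ?gt_eqF// powRr1.
have powR_lt (a b : R) : 0 <= a -> 0 <= b -> (a < b) = (a `^ r < b `^ r).
  move=> a0 b0; apply/idP/idP; first by apply: gt0_ltr_powR.
  by apply: contraTT; rewrite -!leNgt; apply: ge0_ler_powR => //; exact: ltW.
have up : l < (l `^ r + e) `^ r^-1.
  rewrite powR_lt ?powR_ge0// rootK ?ltrDl//; exact: addr_ge0 g0 (ltW e0).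
have nu := cvgr_lt _ ul _ up.
have nl : \forall n \near \oo, l `^ r - e < u n `^ r.
  have [neg|pos] := ltP (l `^ r - e) 0.
    by apply: nearW => n; apply: lt_le_trans neg (powR_ge0 _ _).
  have lo : (l `^ r - e) `^ r^-1 < l.
    by rewrite powR_lt ?powR_ge0// rootK// gtrBl.
  by apply: filterS (cvgr_gt _ ul _ lo) => n; rewrite powR_lt ?powR_ge0// rootK.
near=> n; rewrite ltr_norml.
have h1 : l `^ r - e < u n `^ r by near: n.
have h2 : u n `^ r < l `^ r + e.
  rewrite -[ltRHS]rootK; last exact: addr_ge0 g0 (ltW e0).
  rewrite -powR_lt ?powR_ge0//; near: n; exact: nu.
by apply/andP; split; lra.
Unshelve. all: by end_near. Qed.

(** * The support of a measure and the equivalence of points *)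

Section support.
Context {R : realType} {X : pointedMetricType R}.

Lemma open_mdist_lt (x : X) (e : R) : open [set y | mdist x y < e].
Proof.
have /continuousP := nonexpansive_continuous _ (mdist_nonexpansive x).
by move=> /(_ _ (@open_lt R e)).
Qed.

(** Each point outside the support lies in a null ball centred on the dense sequence with radius
    [1 / (k + 1)], and there are countably many such balls. *)
Lemma negligible_setC_msupport (mu : {measure set (borel X) -> \bar R}) :
  heine_borel X -> mu.-negligible (~` (msupport mu : set (borel X))).
Proof.
move=> hX; have [D dD] := heine_borel_dense_seq hX.
pose B j k : set (borel X) := [set y | mdist (D j) (y : X) < k.+1%:R^-1].
have mB j k : measurable (B j k).
  by apply: open_measurable_borel; exact: open_mdist_lt.
pose N j k := if mu (B j k) == 0%E then B j k else set0.
apply: (@negligibleS _ _ _ _ (\bigcup_j \bigcup_k N j k)); last first.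
  apply: negligible_bigcup => j; apply: negligible_bigcup => k; rewrite /N.
  case: ifPn => [/eqP Bjk|_]; last exact: negligible_set0.
  exact/(negligibleP mu (mB j k)).
move=> x /existsNP[U /not_implyP[oU /not_implyP[Ux /negP]]].
rewrite -leNgt => U0.
have [e e0 eU] : exists2 e : R, 0 < e & forall y : X, mdist x y < e -> U y.
  have /nbhs_ballP[e /= e0 eU] := open_nbhs_nbhs (conj oU Ux).
  by exists e => // y xy; apply: eU; rewrite ballEmdist.
pose k := Num.bound (e / 2)^-1.
have ke : k.+1%:R^-1 < e / 2.
  rewrite invf_plt ?posrE ?divr_gt0//; apply: lt_trans (archi_boundP _) _.
    by rewrite invr_ge0 divr_ge0// ltW.
  by rewrite ltr_nat.
have k0 : 0 < k.+1%:R^-1 :> R by rewrite invr_gt0.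
have [j xj] := dD x _ k0.
exists j => //; exists k => //; rewrite /N.
suff -> : mu (B j k) = 0%E by rewrite eqxx /B /= metric_sym.
apply/eqP; rewrite eq_le measure_ge0 andbT; apply: le_trans U0.
apply: le_measure; rewrite ?inE//; first exact: open_measurable_borel.
move=> y jy; apply: eU; move: jy; rewrite /B /= => jy.
apply: le_lt_trans (metric_triangle x (D j) y) _.
by rewrite [e]splitr ltrD// (lt_trans _ ke).
Qed.

Lemma leadsto_twin (mu : {measure set (borel X) -> \bar R}) (x x' : X) :
  leadsto mu x x' -> \forall e \near (0 : R)^'+, forall z, mdist x z < e ->
    exists2 z', mdist x' z' < e &
      forall y, msupport mu y -> mdist z' y = mdist z y.
Proof.
apply: filterS => e [phi [_ phiB phiE]] z xz.
have := phiB z; rewrite !ballEmdist /= => /(_ xz) x'z'; exists (phi z) => // y ys.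
apply: contrapT => yE.
pose U : set (borel X) := [set y | mdist (phi z : X) (y : X) != mdist z (y : X)].
have oU : open (U : set X).
  rewrite (_ : U = (fun y : X => mdist (phi z : X) y - mdist z y) @^-1` [set r | r != 0]).
    have /continuousP : continuous (fun y : X => mdist (phi z : X) y - mdist z y).
      by move=> t; apply: cvgB;
        exact: (nonexpansive_continuous _ (mdist_nonexpansive _)).
    by apply; exact: open_neq.
  by apply/funext => t; rewrite /U/= subr_eq0.
have := ys U oU; rewrite {1}/U /= => /(_ (introN eqP yE)).
have mU := open_measurable_borel _ oU.
have nU : mu.-negligible U.
  apply: negligibleS (phiE z _); last by rewrite ballEmdist.
  by move=> t /= /eqP.
by move/(negligibleP mu mU) : nU => ->; rewrite ltxx.
Qed.

Lemma leadsto_refl (mu : {measure set (borel X) -> \bar R}) (x : X) :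
  leadsto mu x x.
Proof.
by apply: nearW => e; exists id; split => // z _; exact: aeW.
Qed.

Lemma mu_class_refl (mu : {measure set (borel X) -> \bar R}) (x : X) :
  mu_class mu x x.
Proof. by split; exact: leadsto_refl. Qed.

(** As [x] lies in its own class it belongs to the support, so a twin of [x] is at distance zero
    from it. Twins of [x] exist arbitrarily close to any [c] equivalent to [x], whence [c = x]. *)
Lemma mu_class_singleton (mu : {measure set (borel X) -> \bar R}) (x : X) :
  mu_class mu x `<=` msupport mu -> mu_class mu x = [set x].
Proof.
move=> sub; apply/seteqP; split => [c [xc _]|_ ->]; last exact: mu_class_refl.
apply: mdist_positivity; apply/eqP; rewrite eq_le mdist_ge0 andbT.
apply/ler_addgt0Pl => e e0; rewrite addr0.
have small : \forall e' \near (0 : R)^'+, e' < e by exact: nbhs_right_lt.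
have pos : \forall e' \near (0 : R)^'+, 0 < e' by exact: nbhs_right_gt.
have [e' [e'0 [e'e twin]]] := filter_ex
  (filterI pos (filterI small (leadsto_twin _ _ _ xc))).
have xx : mdist x x < e' by rewrite mdistxx.
have [z' cz' z'E] := twin x xx.
have := z'E x (sub _ (mu_class_refl _ _)); rewrite mdistxx => /mdist_positivity z'x.
by rewrite -z'x ltW// (lt_trans cz').
Qed.

End support.

(** * Almost sure consistency of both means *)

Section consistency.
Context {R : realType} {X : pointedMetricType R} (p : R) (p1 : 1 <= p)
  (hX : heine_borel X) (mu : probability (borel X) R) (hmu : finite_moment p mu)
  {d : measure_display} {Omega : measurableType d} (P : probability Omega R)
  (Y : nat -> {RV P >-> borel X}) (iidY : iid Y mu).

Let p0 : 0 < p. Proof. exact: lt_le_trans p1. Qed.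
Let mu1 : mu setT = 1%E. Proof. exact: probability_setT. Qed.

Local Notation emp w n := (empirical (fun i => Y i w) n.+1).
Local Notation G := (frechet_root p mu).
Local Notation Gn w n := (frechet_root p (emp w n)).

Lemma ae_msupport : {ae P, forall w, forall i, msupport mu (Y i w)}.
Proof.
have [A [mA muA subA]] := negligible_setC_msupport mu hX.
apply/ae_foralln => i; exists (Y i @^-1` A); split.
- by rewrite -[X in measurable X]setTI; exact: measurable_funPT.
- exact: etrans (iidY.2 i A mA) muA.
- by move=> w /= wA; apply: subA.
Qed.

Lemma ae_frechet_root_cvg z :
  {ae P, forall w, Gn w n z @[n --> \oo] --> G z}.
Proof.
have int : (\int[mu]_y (mdist z (y : X) `^ p)%:E = (fine (frechet_functional p mu z))%:E)%E.
  by rewrite fineK// frechet_functional_fin_num.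
have := slln P Y mu iidY (fun y : borel X => mdist z (y : X) `^ p) _
  (measurable_mdist_powR p z) (fun=> powR_ge0 _ _) int.
apply: filterS => w Hw.
rewrite (frechet_rootE p mu p1 hmu z).
have E n : Gn w n z = ((\sum_(i < n.+1) mdist z (Y i w : X) `^ p) / n.+1%:R) `^ p^-1.
  rewrite (frechet_rootE p _ p1 (finite_moment_empirical _ _ p)).
  by rewrite frechet_functional_empirical.
under eq_cvg do rewrite E.
apply: cvg_powR_base => //; first by rewrite invr_gt0.
  by rewrite fine_ge0// integral_ge0// => y _; rewrite lee_fin powR_ge0.
by move=> n; rewrite divr_ge0// sumr_ge0// => i _; exact: powR_ge0.
Qed.

(** If the sample never entered the ball, the averages of its indicator would be zero, whereas the
    strong law sends them to its positive mass. *)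
Lemma ae_hit (x : X) : msupport mu x ->
  {ae P, forall w, forall k, exists i, mdist (Y i w : X) x < k.+1%:R^-1}.
Proof.
move=> xs; apply/ae_foralln => k.
pose B : set (borel X) := [set y | mdist x (y : X) < k.+1%:R^-1].
have oB : @open X B by exact: open_mdist_lt.
have mB : measurable B by exact: open_measurable_borel.
have Bx : B x by rewrite /B /= mdistxx invr_gt0.
have muB := xs B oB Bx.
have int : (\int[mu]_y (\1_B y)%:E = (fine (mu B))%:E)%E.
  by rewrite integral_indic// setIT fineK// fin_num_measure.
have := slln P Y mu iidY (\1_B) _ (measurable_indic mB) _ int.
move=> /(_ (fun _ => ler0n _ _)).
apply: filterS => w Hw; apply: contrapT => /forallNP none.
have S0 n : (\sum_(i < n.+1) \1_B (Y i w)) / n.+1%:R = 0 :> R.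
  rewrite big1 ?mul0r// => i _; rewrite indicE memNset// => YB.
  by apply: (none i); rewrite metric_sym.
have : (fun=> 0 : R) @ \oo --> fine (mu B) by move: Hw; under eq_cvg do rewrite S0.
move=> /(cvg_unique (@Rhausdorff R) (cvg_cst (0 : R))) /esym mB0.
have : 0 < fine (mu B) by rewrite fine_gt0// muB/= ltey_eq fin_num_measure.
by rewrite mB0 ltxx.
Qed.

Lemma ae_frechet_root_cvg_all :
  {ae P, forall w, forall z, Gn w n z @[n --> \oo] --> G z}.
Proof.
have [D dD] := heine_borel_dense_seq hX.
have : {ae P, forall w, forall j, Gn w n (D j) @[n --> \oo] --> G (D j)}.
  by apply/ae_foralln => j; exact: ae_frechet_root_cvg.
apply: filterS => w Hw; apply: (nonexpansive_cvg D) => //.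
- exact: frechet_root_nonexpansive.
- move=> n; apply: frechet_root_nonexpansive => //.
    exact: empirical_setT.
  exact: finite_moment_empirical.
Qed.

Lemma empirical_frechet_root w n :
  nonexpansive (Gn w n) /\ distance_bounding (Gn w n).
Proof.
by split; [apply: frechet_root_nonexpansive|
  apply: frechet_root_distance_bounding];
  [done|exact: empirical_setT|exact: finite_moment_empirical|
   done|exact: empirical_setT|exact: finite_moment_empirical].
Qed.

Lemma frechet_mean_consistency (x : X) : frechet_mean p mu = mu_class mu x ->
  {ae P, forall w, cvg_fell_upper_hausdorff
    (fun n => frechet_mean p (emp w n)) (frechet_mean p mu)}.
Proof.
move=> FE.
have lipG := frechet_root_nonexpansive p mu p1 mu1 hmu.
have bdG := frechet_root_distance_bounding p mu p1 mu1 hmu.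
have FA := frechet_mean_argmin p mu p1 hmu.
have FnA w n := frechet_mean_argmin p (emp w n) p1
  (finite_moment_empirical _ n p).
have T0 : [set: X] !=set0 by exists point.
have Fx : argmin setT G x by rewrite -FA FE; exact: mu_class_refl.
have := ae_msupport; apply: filterS2 ae_frechet_root_cvg_all => w cvgG Ys.
have nexp n := (empirical_frechet_root w n).1.
have bnd n := (empirical_frechet_root w n).2.
have An0 n : frechet_mean p (emp w n) !=set0.
  by rewrite FnA; apply: argmin_nonempty => //; exact: closedT.
have Usub U : open U -> frechet_mean p mu `<=` U ->
    \forall n \near \oo, frechet_mean p (emp w n) `<=` U.
  move=> oU; rewrite FA => FU.
  under eq_near do rewrite FnA.
  apply: (argmin_eventually_sub (fun=> setT) setT _ G x U) => //.
  by move=> e e0; apply: nearW => n; exists x; rewrite ?mdistxx.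
apply: cvg_fell_upper_hausdorffP => //.
- by move=> n; rewrite FnA; apply: argmin_compact => //; exact: closedT.
- by rewrite FA; exists x.
- by rewrite FA; apply: argmin_compact => //; exact: closedT.
move=> U oU [u [Fu Uu]].
(* Points with a twin in [U]: replacing a minimiser by its twin changes neither
   the distances to the sample nor, hence, the empirical functional. *)
pose V := [set z | exists2 z', U z' &
  forall y, msupport mu y -> mdist z' y = mdist z y].
have [r r0 rU] : exists2 r : R, 0 < r & forall y : X, mdist u y < r -> U y.
  have /nbhs_ballP[r /= r0 rU] := open_nbhs_nbhs (conj oU Uu).
  by exists r => // y uy; apply: rU; rewrite ballEmdist.
(* Transport in two moves: a point near the minimiser [c] has a twin near [x], which in turn has a
   twin near [u], inside [U]. *)
have FV : frechet_mean p mu `<=` V^°.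
  move=> c; move: Fu; rewrite FE => -[xu _] [_ cx].
  have small : \forall e \near (0 : R)^'+, e < r by exact: nbhs_right_lt.
  have pos : \forall e \near (0 : R)^'+, 0 < e by exact: nbhs_right_gt.
  have [e [e0 [er [tcx txu]]]] := filter_ex (filterI pos (filterI small
    (filterI (leadsto_twin _ _ _ cx) (leadsto_twin _ _ _ xu)))).
  apply/nbhs_ballP; exists e => // z; rewrite ballEmdist /= => cz.
  have [z1 xz1 z1E] := tcx z cz; have [z2 uz2 z2E] := txu z1 xz1.
  exists z2; first by apply: rU; exact: lt_trans er.
  by move=> y ys; rewrite z2E// z1E.
(* The upper half, applied to the interior of [V], gives an empirical minimiser a twin in [U], and
   that twin is a minimiser too. *)
apply: filterS (Usub _ (@open_interior _ V) FV) => n sub.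
have [z Fz] := An0 n.
have [z' Uz' z'E] := interior_subset (sub z Fz).
exists z'; (split; last exact: Uz') => y; have := Fz y.
rewrite !frechet_functional_empirical => le_zy.
by rewrite (eq_bigr (fun i : 'I_n.+1 => mdist z (Y i w : X) `^ p)) => // i _; rewrite z'E.
Qed.

(** Being made of restricted minimisers, the class lies in the support and is the singleton of [x].
    The lower half then follows from the upper half and nonemptiness. *)
Lemma restricted_frechet_mean_consistency (x : X) :
  restricted_frechet_mean p mu = mu_class mu x ->
  {ae P, forall w, cvg_fell_upper_hausdorff
    (fun n => restricted_frechet_mean p (emp w n))
    (restricted_frechet_mean p mu)}.
Proof.
move=> FE.
have lipG := frechet_root_nonexpansive p mu p1 mu1 hmu.
have bdG := frechet_root_distance_bounding p mu p1 mu1 hmu.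
have FA := restricted_frechet_mean_argmin p mu p1 hmu.
have FnA w n := restricted_frechet_mean_argmin p (emp w n) p1
  (finite_moment_empirical _ n p).
have Fsingle : restricted_frechet_mean p mu = [set x].
  by rewrite FE; apply: mu_class_singleton; rewrite -FE => c [].
have Fx : argmin (msupport mu) G x by rewrite -FA FE; exact: mu_class_refl.
have := ae_hit x Fx.1.
apply: filterS3 ae_msupport ae_frechet_root_cvg_all => w Ys cvgG hit.
have nexp n := (empirical_frechet_root w n).1.
have bnd n := (empirical_frechet_root w n).2.
have An0 n : restricted_frechet_mean p (emp w n) !=set0.
  rewrite FnA; apply: argmin_nonempty => //; first exact: closed_msupport.
  by rewrite msupport_empirical; exists (Y 0%N w); exists 0%N.
have Usub U : open U -> restricted_frechet_mean p mu `<=` U ->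
    \forall n \near \oo, restricted_frechet_mean p (emp w n) `<=` U.
  move=> oU; rewrite FA => FU.
  under eq_near do rewrite FnA.
  apply: (argmin_eventually_sub (fun n => msupport (emp w n)) (msupport mu) _ G x U) => //.
  - exact: closed_msupport.
  - by move=> n z; rewrite msupport_empirical => -[i _ <-].
  (* A sample point that has come within [e] of [x] stays in the sample for every later [n]. *)
  - move=> e e0; pose k := Num.bound e^-1.
    have [i Yi] := hit k.
    exists i => // n /= i_n; exists (Y i w).
      by rewrite msupport_empirical; exists i => //=; rewrite ltnS.
    apply: lt_trans Yi _; rewrite invf_plt ?posrE//.
    apply: lt_trans (archi_boundP _) _; first by rewrite invr_ge0 ltW.
    by rewrite ltr_nat.
apply: cvg_fell_upper_hausdorffP => //.
- by move=> n; rewrite FnA; apply: argmin_compact => //; exact: closed_msupport.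
- by rewrite FA; exists x.
- by rewrite FA; apply: argmin_compact => //; exact: closed_msupport.
move=> U oU [u []]; rewrite Fsingle => -> Ux.
have sub : restricted_frechet_mean p mu `<=` U by rewrite Fsingle => _ ->.
apply: filterS (Usub U oU sub) => n subn.
by have [z Fz] := An0 n; exists z; split => //; exact: subn.
Qed.

End consistency.

Theorem theorem4p13 (R : realType) (p : R) (hp : 1 <= p)
    (X : pointedMetricType R) (hX : heine_borel X)
    (mu : probability (borel X) R) (hmu : finite_moment p mu)
    (d : measure_display) (Omega : measurableType d)
    (P : probability Omega R) (hP : measure_is_complete P)
    (Y : nat -> {RV P >-> borel X}) (hY : iid Y mu) :
  ((exists x : X, frechet_mean p mu = mu_class mu x) ->
     {ae P, forall w, cvg_fell_upper_hausdorff
       (fun n => frechet_mean p (empirical (fun i => Y i w) n.+1))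
       (frechet_mean p mu)})
  /\
  ((exists x : X, restricted_frechet_mean p mu = mu_class mu x) ->
     {ae P, forall w, cvg_fell_upper_hausdorff
       (fun n => restricted_frechet_mean p (empirical (fun i => Y i w) n.+1))
       (restricted_frechet_mean p mu)}).
Proof.
split=> -[x Fx].
  exact: (frechet_mean_consistency p hp hX mu hmu P Y hY x Fx).
exact: (restricted_frechet_mean_consistency p hp hX mu hmu P Y hY x Fx).
Qed.
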